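(* Let $\Gamma$ be a $\mathbb Z^d$-periodic graph, $d\ge2$, with fundamental graph $\Gamma_*=(V_*,\mathcal E_* )$, $\nu=\#V_*$, and let $H=\Delta+Q$ with an arbitrary real $\mathbb Z^d$-periodic potential $Q$ (notation as in the context). Then the Lebesgue measure of the spectrum satisfies $$|\sigma(H)|\le\sum_{n=1}^{\nu}|\sigma_n(H)|\le 2\beta,\qquad \beta=\sum_{v\in V_*}\frac{\beta_v}{\varkappa_v},$$ where $\beta_v$ is the number of bridges of $\Gamma_*$ (oriented edges of $\Gamma_*$ with nonzero index) starting at $v$. Moreover, if the spectrum of $H$ has $s$ gaps $\gamma_1(H),\dots,\gamma_s(H)$, then $$\sum_{n=1}^s|\gamma_n(H)|\ge \lambda^+_\nu-\lambda^-_1-2\beta\ge C_0-2\beta,\qquad C_0=|\lambda^{0+}_\nu-q_\bullet|,\quad q_\bullet=\max_{v\in V_*}Q(v)-\min_{v\in V_*}Q(v),$$ where $\lambda^{0+}_\nu$ is the right endpoint of the spectrum of $\Delta$ and $\lambda^-_1$, $\lambda^+_\nu$ are the left and right endpoints of the spectrum of $H$.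
   Context: Setting. $\Gamma=(V,\mathcal E)$ is a connected infinite graph, possibly with loops and multiple edges, on which $\mathbb Z^d$ acts freely by graph automorphisms ($v\mapsto v+m$), every vertex has finite degree, and the quotient graph $\Gamma_*=\Gamma/\mathbb Z^d=(V_*,\mathcal E_* )$ is finite, $\nu=\#V_*$. Each undirected edge is regarded as two oppositely oriented edges; $\mathcal A$ is the set of oriented edges of $\Gamma$, $\mathcal A_*=\mathcal A/\mathbb Z^d$. The degree $\varkappa_v$ is the number of oriented edges starting at $v$. $(\Delta f)(v)=f(v)-\sum_{(v,u)\in\mathcal A}\frac{1}{\sqrt{\varkappa_v\varkappa_u}}f(u)$ on $\ell^2(V)$, $H=\Delta+Q$ with $Q$ real and $Q(v+m)=Q(v)$. Edge indices. Fix a subtree $T$ of $\Gamma$ whose vertex set $V_0$ consists of $\nu$ pairwise non-$\mathbb Z^d$-equivalent vertices; write each $v\in V$ uniquely as $v=v_0+[v]$, $v_0\in V_0$, $[v]\in\mathbb Z^d$; the index of $\mathbf e=(u,v)$ is $\tau(\mathbf e)=[v]-[u]$, which is shift invariant and thus defined on $\mathcal A_*$. Bridges are edges with nonzero index. Fiber operators and bands. For $\vartheta\in\mathbb T^d=\mathbb R^d/(2\pi\mathbb Z)^d$: $(\Delta(\vartheta)f)(v)=f(v)-\sum_{\mathbf e=(v,u)\in\mathcal A_*}\frac{e^{i\langle\tau(\mathbf e),\vartheta\rangle}}{\sqrt{\varkappa_v\varkappa_u}}f(u)$ on $\ell^2(V_* )$, $H(\vartheta)=\Delta(\vartheta)+Q$;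 $H$ is unitarily equivalent to the direct integral of $H(\vartheta)$. Eigenvalues $\lambda_1(\vartheta)\le\dots\le\lambda_\nu(\vartheta)$ of $H(\vartheta)$ define bands $\sigma_n(H)=[\lambda_n^-,\lambda_n^+]=\lambda_n(\mathbb T^d)$, $\sigma(H)=\bigcup_n\sigma_n(H)$; for $\Delta$ the eigenvalues are $\lambda^0_n(\vartheta)$ and bands $[\lambda_n^{0-},\lambda_n^{0+}]$. A band is degenerate if it is a single point (an eigenvalue of infinite multiplicity). A gap is a nonempty open interval between two neighboring nondegenerate bands.
   Formalization: Gaps are taken as all bounded components of the complement of the spectrum, so intervals next to degenerate bands count; with gaps only between nondegenerate bands the bound fails when the top band is an isolated single point. *)

(* Defs.v *)
From HB Require Import structures.
From mathcomp Require Import all_boot all_order all_algebra.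
From mathcomp Require Import all_classical all_reals all_analysis.
From mathcomp Require Import complex.
From Stdlib Require Import Relations.

Set Implicit Arguments.
Unset Strict Implicit.
Unset Printing Implicit Defensive.

Import Order.TTheory GRing.Theory Num.Theory.
Local Open Scope ring_scope.

(* A Z^d-periodic graph Gamma is encoded by its fundamental graph            *)
(*   Gamma_* : vertex set V_* = 'I_nu, finite set E of oriented edges         *)
(*   (the paper's A_* ), source/target maps, orientation reversal [rev] and the edge      *)
(*   index [tau : E -> Z^d].  The periodic graph itself is recovered as the  *)
(*   derived graph: vertices V_* x Z^d, with an oriented edge                *)
(*   (src e, m) -> (tgt e, m + tau e) for each e in E and m in Z^d.          *)
(*   The vertex v_0 + m of the paper is (v_0, m).                            *)

Section PeriodicGraph.
Variables (d nu : nat) (E : finType) (src tgt : E -> 'I_nu) (rev : E -> E)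
  (tau : E -> 'rV[int]_d).

(* each undirected edge is a pair of two opposite oriented edges *)
Definition orientation_ok : Prop :=
  (forall e, rev (rev e) = e) /\ (forall e, rev e <> e) /\
  (forall e, src (rev e) = tgt e) /\ (forall e, tgt (rev e) = src e) /\
  (forall e, tau (rev e) = - tau e).

Definition Gamma_adj (x y : 'I_nu * 'rV[int]_d) : Prop :=
  exists e, src e = x.1 /\ tgt e = y.1 /\ y.2 = x.2 + tau e.

Definition Gamma_connected : Prop :=
  forall x y, clos_refl_trans _ Gamma_adj x y.

(* The indices come from a subtree T of Gamma on the representatives
   V_0 = V_* x {0}: equivalently, the edges of index 0 connect V_*. *)
Definition zero_index_adj (u v : 'I_nu) : Prop :=
  exists e, src e = u /\ tgt e = v /\ tau e = 0.

Definition indices_from_tree : Prop :=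
  forall u v, clos_refl_trans _ zero_index_adj u v.

Definition kappa (v : 'I_nu) : nat := #|[set e | src e == v]|.

Definition beta_v (v : 'I_nu) : nat := #|[set e | (src e == v) && (tau e != 0)]|.

Variable R : realType.

Definition beta : R := \sum_(v < nu) (beta_v v)%:R / (kappa v)%:R.

Local Open Scope complex_scope.

Definition pairing (m : 'rV[int]_d) (theta : 'rV[R]_d) : R :=
  \sum_(i < d) (m ord0 i)%:~R * theta ord0 i.

Definition expi (t : R) : R[i] := (cos t) +i* (sin t).

(* Fiber operator H(theta) = Delta(theta) + Q on l^2(V_* ) *)
Definition Hfib (Q : 'I_nu -> R) (theta : 'rV[R]_d) : 'M[R[i]]_nu :=
  \matrix_(v, u)
    ((((v == u)%:R + (if v == u then Q v else 0)) : R)%:C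
     - \sum_(e | (src e == v) && (tgt e == u))
          expi (pairing (tau e) theta)
          * ((Num.sqrt ((kappa v)%:R * (kappa u)%:R : R))^-1)%:C).

Definition is_sorted_spectrum (A : 'M[R[i]]_nu) (s : seq R) : Prop :=
  sorted <=%R s /\ char_poly A = \prod_(x <- s) ('X - (x%:C)%:P).

Definition eigs (Q : 'I_nu -> R) (theta : 'rV[R]_d) : seq R :=
  xget [::] (is_sorted_spectrum (Hfib Q theta)).

(* lambda_{n+1}(theta)  (0-based index n) *)
Definition lam (Q : 'I_nu -> R) (n : nat) (theta : 'rV[R]_d) : R :=
  nth 0 (eigs Q theta) n.

Local Close Scope complex_scope.
Local Open Scope classical_set_scope.

(* band sigma_{n+1}(H) = lambda_{n+1}(T^d)  (lambda is 2pi-periodic in theta) *)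
Definition band (Q : 'I_nu -> R) (n : nat) : set R := range (lam Q n).

Definition band_lo (Q : 'I_nu -> R) (n : nat) : R := inf (band Q n).
Definition band_hi (Q : 'I_nu -> R) (n : nat) : R := sup (band Q n).

Definition spectrum (Q : 'I_nu -> R) : set R :=
  \bigcup_(n < nu) band Q n.

Definition is_gap (Q : 'I_nu -> R) (g : R * R) : Prop :=
  (g.1 < g.2)%R /\ spectrum Q g.1 /\ spectrum Q g.2 /\
  `]g.1, g.2[ `&` spectrum Q = set0.

Definition qbullet (Q : 'I_nu -> R) : R := sup (range Q) - inf (range Q).

End PeriodicGraph.

(* Main.v *)
Require Import Defs.
From HB Require Import structures.
From mathcomp Require Import all_boot all_order all_algebra.
From mathcomp Require Import all_classical all_reals all_analysis.
From mathcomp Require Import complex perm measurable_realfun ring lra.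
From Stdlib Require Import Relations.
Import Order.TTheory GRing.Theory Num.Theory.
Local Open Scope ring_scope.

Set Implicit Arguments.
Unset Strict Implicit.
Unset Printing Implicit Defensive.

Import numFieldNormedType.Exports.

(* Write H(theta) = B - W(theta), where W(theta) collects the bridges and B does
   not depend on theta.  By the inequality 2|xy| <= |x|^2 + |y|^2 applied edge
   by edge, -D <= W(theta) <= D as quadratic forms, where D is the diagonal
   matrix with entries beta_v / kappa_v.  Monotonicity of ordered eigenvalues
   puts the n-th band between the n-th eigenvalues of B - D and B + D, and the
   sum over n of these lengths is tr (2 D) = 2 beta.  The same monotonicity
   makes the lambda_n continuous, hence the bands compact, so the spectrum is
   closed and every point of [lambda_1^-, lambda_nu^+] outside it lies in a gap.
   For the last bound, the square root of the degree is a zero mode of the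
   Laplacian, which is nonnegative, and Q is a diagonal perturbation of it. *)

Section QuadraticForms.
Local Open Scope sesquilinear_scope.
Variables (C : numClosedFieldType) (n : nat).
Implicit Types (A B : 'M[C]_n) (d x : 'rV[C]_n).

Lemma hermsymmxP A : reflect (A^t* = A) (A \is hermsymmx).
Proof.
rewrite is_hermitianmxE expr0 scale1r.
by apply: (iffP eqP) => /esym.
Qed.

Lemma hermsymmxD A B :
  A \is hermsymmx -> B \is hermsymmx -> A + B \is hermsymmx.
Proof.
move=> /hermsymmxP Ah /hermsymmxP Bh; apply/hermsymmxP.
by rewrite linearD /= map_mxD Ah Bh.
Qed.

Lemma hermsymmxN A : A \is hermsymmx -> - A \is hermsymmx.
Proof.
by move=> /hermsymmxP Ah; apply/hermsymmxP; rewrite linearN /= map_mxN Ah.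
Qed.

Lemma hermsymmx_diag d : d \is a mxOver Num.real -> diag_mx d \is hermsymmx.
Proof.
move=> /mxOverP dr; apply/hermsymmxP; rewrite tr_diag_mx map_diag_mx.
by congr diag_mx; apply/rowP => i; rewrite mxE; exact/CrealP/dr.
Qed.

Definition qform A x : C := (x *m A *m x^t*) 0 0.

Definition loewner_le A B : Prop := forall x, qform A x <= qform B x.

Lemma qformE A x : qform A x = \sum_i \sum_j x 0 i * A i j * (x 0 j)^*.
Proof.
rewrite /qform mxE exchange_big; apply: eq_bigr => j _.
by rewrite !mxE mulr_suml.
Qed.

Lemma qformD A B x : qform (A + B) x = qform A x + qform B x.
Proof. by rewrite /qform mulmxDr mulmxDl mxE. Qed.

Lemma qformN A x : qform (- A) x = - qform A x.
Proof. by rewrite /qform mulmxN mulNmx mxE. Qed.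

Lemma qform_diag d x : qform (diag_mx d) x = \sum_i d 0 i * `|x 0 i| ^+ 2.
Proof.
rewrite /qform mul_mx_diag mxE; apply: eq_bigr => i _.
by rewrite !mxE mulrAC mulrC normCK.
Qed.

Lemma qform_scalar (a : C) x : qform a%:M x = a * dotmx x x.
Proof. by rewrite /qform mul_mx_scalar -scalemxAl mxE dotmxE. Qed.

Lemma qform_delta A i : qform A (delta_mx 0 i) = A i i.
Proof. by rewrite /qform -rowE trmx_delta map_delta_mx -colE !mxE. Qed.

Lemma dotmx_delta (i : 'I_n) :
  dotmx (delta_mx 0 i : 'rV[C]_n) (delta_mx 0 i) = 1.
Proof. by rewrite -[LHS]mul1r -qform_scalar qform_delta mxE eqxx. Qed.

Lemma qform_conj A B x : qform (B *m A *m B^t*) x = qform A (x *m B).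
Proof. by rewrite /qform trmx_mul map_mxM !mulmxA. Qed.

Lemma qform_real A x : A \is hermsymmx -> qform A x \is Num.real.
Proof.
move=> /hermsymmxP/matrixP AhE; apply/CrealP.
have Ah i j : (A i j)^* = A j i by rewrite -[RHS]AhE !mxE.
rewrite !qformE rmorph_sum exchange_big; apply: eq_bigr => j _ /=.
rewrite rmorph_sum; apply: eq_bigr => i _ /=.
by rewrite !rmorphM /= conjCK Ah mulrC [X in _ * X]mulrC mulrA.
Qed.

Lemma loewner_le_trans A B D :
  loewner_le A B -> loewner_le B D -> loewner_le A D.
Proof. by move=> AB BD x; apply: le_trans (AB x) (BD x). Qed.

Lemma loewner_leD2l A B D : loewner_le B D -> loewner_le (A + B) (A + D).
Proof. by move=> BD x; rewrite !qformD lerD2l. Qed.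

Lemma loewner_leN2 A B : loewner_le A B -> loewner_le (- B) (- A).
Proof. by move=> AB x; rewrite !qformN lerN2. Qed.

Lemma loewner_le_conj A B D :
  loewner_le A B -> loewner_le (D *m A *m D^t*) (D *m B *m D^t*).
Proof. by move=> AB x; rewrite !qform_conj. Qed.

Lemma loewner_le_diag (d e : 'rV[C]_n) :
  (forall i, d 0 i <= e 0 i) -> loewner_le (diag_mx d) (diag_mx e).
Proof.
by move=> de x; rewrite !qform_diag; apply: ler_sum => i _; rewrite ler_wpM2r.
Qed.

End QuadraticForms.

Lemma char_poly_conj (F : fieldType) n (P A : 'M[F]_n) : P \in unitmx ->
  char_poly (invmx P *m A *m P) = char_poly A.
Proof.
move=> Pu; rewrite /char_poly /char_poly_mx.
pose Pp := map_mx polyC P; pose Vp := map_mx polyC (invmx P).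
have VP : Vp *m Pp = 1%:M by rewrite -map_mxM mulVmx // map_mx1.
have -> : 'X%:M - map_mx polyC (invmx P *m A *m P)
    = Vp *m ('X%:M - map_mx polyC A) *m Pp.
  rewrite mulmxBr mulmxBl -!map_mxM scalar_mxC.
  by rewrite -[_%:M *m _ *m _]mulmxA VP mulmx1.
by rewrite !det_mulmx mulrAC -det_mulmx VP det1 mul1r.
Qed.

(* The conditions are at most n - 1 linear equations: x annihilates a matrix
   with a zero column. *)
Lemma split_kernel_vector (F : fieldType) n (P S : 'M[F]_n) k : (k < n)%N ->
  exists x : 'rV_n, [/\ x != 0,
    forall i : 'I_n, (i < k)%N -> (x *m P) 0 i = 0 &
    forall i : 'I_n, (k < i)%N -> (x *m S) 0 i = 0].
Proof.
move=> kn; pose M : 'M[F]_n := \matrix_(i, j)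
  if (j < k)%N then P i j else if (k < j)%N then S i j else 0.
have /eqP/det0P[x x0 /rowP xM] : \det M = 0.
  rewrite (expand_det_col M (Ordinal kn)) big1 // => i _.
  by rewrite mxE /= ltnn mul0r.
exists x; split => // i ik; have := xM i; rewrite !mxE => xMi.
  by rewrite -[RHS]xMi; apply: eq_bigr => j _; rewrite mxE ik.
by rewrite -[RHS]xMi; apply: eq_bigr => j _; rewrite mxE ltnNge (ltnW ik) ik.
Qed.

Section Eigenframes.
Local Open Scope sesquilinear_scope.
Variables (C : numClosedFieldType) (n : nat).
Implicit Types (A B P S : 'M[C]_n) (x : 'rV[C]_n) (s t : seq C).

Definition eigenframe A s P : Prop :=
  [/\ P \is unitarymx, sorted <=%R s, size s = n &
      A = P^t* *m diag_mx (\row_i s`_i) *m P].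

Lemma unitary_row_perm (p : 'S_n) P :
  P \is unitarymx -> row_perm p P \is unitarymx.
Proof.
move=> /row_unitarymxP Pu; apply/row_unitarymxP => i j.
have rowE l : row l (row_perm p P) = row (p l) P.
  by apply/rowP => m; rewrite !mxE.
by rewrite !rowE Pu (inj_eq perm_inj).
Qed.

Lemma row_perm_conj_diag_mx (p : 'S_n) P (d : 'rV[C]_n) :
  (row_perm p P)^t* *m diag_mx (col_perm p d) *m row_perm p P
  = P^t* *m diag_mx d *m P.
Proof.
apply/matrixP => i j; rewrite !mul_mx_diag [LHS]mxE [RHS]mxE.
rewrite [RHS](reindex_inj (@perm_inj _ p)).
by apply: eq_bigr => k _; rewrite !mxE.
Qed.

Lemma hermitian_eigenframe A : A \is hermsymmx ->
  exists s P, eigenframe A s P /\ all [in Num.real] s.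
Proof.
move=> Ah; have := spectral_unitarymx A.
have /orthomx_spectralP := hermitian_normalmx Ah.
have /mxOverP := hermitian_spectral_diag_real Ah.
move: (spectralmx A) (spectral_diag A) => P d dreal AE Pu.
rewrite invmx_unitary // in AE.
pose d_seq := [tuple d 0 i | i < n].
have d_seq_real : all [in Num.real] d_seq.
  by apply/allP => _ /mapP[i _ ->]; exact: dreal.
have /tuple_permP[p sortE] : perm_eq (sort <=%R d_seq) d_seq.
  by rewrite perm_sort.
exists (sort <=%R d_seq), (row_perm p P); split; last by rewrite all_sort.
split; first exact: unitary_row_perm.
- apply: (@sort_sorted_in _ [in Num.real]) d_seq_real => y z.
  exact: real_leVge.
- by rewrite size_sort size_tuple.
rewrite AE -[LHS](row_perm_conj_diag_mx p); congr (_ *m diag_mx _ *m _).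
apply/rowP => i; rewrite !mxE sortE (nth_map i) ?size_enum_ord //.
by rewrite nth_ord_enum tnth_mktuple.
Qed.

Lemma eigenframe_char_poly A s P : eigenframe A s P ->
  char_poly A = \prod_(y <- s) ('X - y%:P).
Proof.
move=> [Pu _ sz ->]; rewrite -invmx_unitary //.
rewrite char_poly_conj ?unitarymx_unit // char_poly_trig ?diag_mx_is_trig //.
rewrite [in RHS](big_nth 0) sz big_mkord.
by apply: eq_bigr => i _; rewrite !mxE eqxx.
Qed.

Lemma eigenframe_trace A s P : eigenframe A s P -> \tr A = \sum_(i < n) s`_i.
Proof.
move=> [Pu _ _ ->]; rewrite mxtrace_mulC mulmxA (unitarymxP Pu) mul1mx.
by rewrite mxtrace_diag; apply: eq_bigr => i _; rewrite mxE.
Qed.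

Lemma eigenframe_shift (a : C) A s P :
  eigenframe A s P -> eigenframe (A + a%:M) [seq y + a | y <- s] P.
Proof.
move=> [Pu ss sz AE]; split => //; last 1 first.
- have -> : diag_mx (\row_i [seq y + a | y <- s]`_i)
      = diag_mx (\row_i s`_i) + a%:M :> 'M[C]_n.
    rewrite -diag_const_mx -linearD; congr diag_mx; apply/rowP => i.
    by rewrite !mxE (nth_map 0) ?sz.
  rewrite mulmxDr mulmxDl -AE mul_mx_scalar -scalemxAl -invmx_unitary //.
  by rewrite mulVmx ?unitarymx_unit // scalemx1.
- by rewrite sorted_map; apply: sub_sorted ss => y z yz /=; rewrite lerD2r.
- by rewrite size_map.
Qed.

Lemma eigenframe_nth_le A s P i j : eigenframe A s P ->
  (i <= j)%N -> (j < n)%N -> s`_i <= s`_j.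
Proof.
move=> [_ ss sz _] ij jn.
by rewrite (sorted_leq_nth le_trans le_refl) ?inE ?sz ?(leq_ltn_trans ij).
Qed.

Lemma eigenframe_qform A s P x : eigenframe A s P ->
  qform A x = \sum_(i < n) s`_i * `|(x *m P^t*) 0 i| ^+ 2.
Proof.
move=> [_ _ _ ->]; rewrite -{2}(trmxCK P) qform_conj qform_diag.
by apply: eq_bigr => i _; rewrite mxE.
Qed.

Lemma unitary_dotmx P x : P \is unitarymx ->
  dotmx x x = \sum_i `|(x *m P^t*) 0 i| ^+ 2.
Proof.
move=> Pu; transitivity (dotmx (x *m P^t*) (x *m P^t*)).
  by rewrite !dotmxE trmx_mul map_mxM trmxCK mulmxA mulmxKtV.
by rewrite dotmxE mxE; apply: eq_bigr => i _; rewrite !mxE normCK.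
Qed.

Lemma eigenframe_qform_ge A s P k x : eigenframe A s P ->
  (forall i : 'I_n, (i < k)%N -> (x *m P^t*) 0 i = 0) ->
  s`_k * dotmx x x <= qform A x.
Proof.
move=> AsP x0; have [Pu _ _ _] := AsP.
rewrite (eigenframe_qform _ AsP) (unitary_dotmx _ Pu) mulr_sumr.
apply: ler_sum => i _; case: (ltnP i k) => [ik|ki].
  by rewrite x0 // normr0 expr0n !mulr0.
by rewrite ler_wpM2r // (eigenframe_nth_le AsP).
Qed.

Lemma eigenframe_qform_le A s P k x : eigenframe A s P -> (k < n)%N ->
  (forall i : 'I_n, (k < i)%N -> (x *m P^t*) 0 i = 0) ->
  qform A x <= s`_k * dotmx x x.
Proof.
move=> AsP kn x0; have [Pu _ _ _] := AsP.
rewrite (eigenframe_qform _ AsP) (unitary_dotmx _ Pu) mulr_sumr.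
apply: ler_sum => i _; case: (ltnP k i) => [ki|ik].
  by rewrite x0 // normr0 expr0n !mulr0.
by rewrite ler_wpM2r // (eigenframe_nth_le AsP).
Qed.

Lemma eigenframe_monotone A B s t P S k :
  eigenframe A s P -> eigenframe B t S -> loewner_le A B -> (k < n)%N ->
  s`_k <= t`_k.
Proof.
move=> AsP BtS AB kn.
have [x [x0 xP xS]] := split_kernel_vector (P^t*) (S^t*) kn.
rewrite -(@ler_pM2r _ (dotmx x x)) ?dnorm_gt0 //.
apply: le_trans (eigenframe_qform_ge AsP xP) _.
exact: le_trans (AB x) (eigenframe_qform_le BtS kn xS).
Qed.

End Eigenframes.

Section RealDiagonals.
Local Open Scope complex_scope.
Variables (R : rcfType) (n : nat).
Implicit Types (f g : 'I_n -> R) (s : seq R).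

Lemma nth_real_complex s k : [seq y%:C | y <- s]`_k = (s`_k)%:C.
Proof.
case: (ltnP k (size s)) => sk; first by rewrite (nth_map 0).
by rewrite !nth_default ?size_map.
Qed.

Definition real_diag f : 'M[R[i]]_n := diag_mx (\row_i (f i)%:C).

Lemma real_diagD f g :
  real_diag (fun i => f i + g i) = real_diag f + real_diag g.
Proof.
by rewrite -raddfD; congr diag_mx; apply/rowP => i; rewrite !mxE rmorphD.
Qed.

Lemma real_diag_hermitian f : real_diag f \is hermsymmx.
Proof.
apply/hermsymmx_diag/mxOverP => i j; rewrite mxE.
by apply/complex_realP; exists (f j).
Qed.

Lemma real_diag_le f g :
  (forall i, f i <= g i) -> loewner_le (real_diag f) (real_diag g).
Proof. by move=> fg; apply: loewner_le_diag => i; rewrite !mxE lecR. Qed.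

Lemma real_diag_const (a : R) : real_diag (fun=> a) = a%:C%:M.
Proof.
by rewrite -diag_const_mx; congr diag_mx; apply/rowP => i; rewrite !mxE.
Qed.

End RealDiagonals.

(* Locked because conversion between two spectra would unfold the choice
   operator and then the matrices. *)
HB.lock Definition eigenvalues (R : realType) (n : nat) (A : 'M[R[i]]_n) :
    seq R :=
  xget [::] (is_sorted_spectrum A).
Canonical eigenvalues_unlockable := Unlockable eigenvalues.unlock.

Section RealEigenvalues.
Local Open Scope complex_scope.
Variables (R : realType) (n : nat).
Implicit Types (A B : 'M[R[i]]_n) (x : 'rV[R[i]]_n) (s t : seq R).

Lemma is_sorted_spectrum_unique A s t :
  is_sorted_spectrum A s -> is_sorted_spectrum A t -> s = t.
Proof.
move=> [ss sE] [ts tE]; apply: le_sorted_eq => //.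
apply: (perm_map_inj (@complexI R)).
by apply: prod_XsubC_eq; rewrite !big_map -sE tE.
Qed.

Lemma eigenvalues_frame A : A \is hermsymmx ->
  exists P, eigenframe A [seq y%:C | y <- eigenvalues A] P.
Proof.
move=> /hermitian_eigenframe[s [P [AsP /allP s_real]]]; exists P.
pose t := map (@complex.Re R) s.
have sE : s = [seq y%:C | y <- t].
  by rewrite -map_comp -[LHS]map_id; apply/eq_in_map => z /s_real/RRe_real.
have tA : is_sorted_spectrum A t.
  split; last by rewrite (eigenframe_char_poly AsP) sE big_map.
  have [_ + _ _] := AsP; rewrite sE sorted_map; apply: sub_sorted => y z.
  by rewrite /= lecR.
have -> : eigenvalues A = t.
  rewrite unlock.
  exact: is_sorted_spectrum_unique (xgetPex _ (ex_intro _ t tA)) tA.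
by rewrite -sE.
Qed.

Lemma size_eigenvalues A : A \is hermsymmx -> size (eigenvalues A) = n.
Proof. by move=> /eigenvalues_frame[P [_ _ + _]]; rewrite size_map. Qed.

Lemma eigenvalues_default A k : A \is hermsymmx -> (n <= k)%N ->
  (eigenvalues A)`_k = 0.
Proof. by move=> Ah nk; rewrite nth_default ?size_eigenvalues. Qed.

Lemma le_eigenvaluesD A B (a : R) k : A \is hermsymmx -> B \is hermsymmx ->
  loewner_le A (B + a%:C%:M) -> (k < n)%N ->
  (eigenvalues A)`_k <= (eigenvalues B)`_k + a.
Proof.
move=> Ah Bh AB kn; have [P AsP] := eigenvalues_frame Ah.
have [S /(eigenframe_shift a%:C) BtS] := eigenvalues_frame Bh.
have := eigenframe_monotone AsP BtS AB kn.
have -> : [seq y + a%:C | y <- [seq y%:C | y <- eigenvalues B]]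
    = [seq y%:C | y <- [seq y + a | y <- eigenvalues B]].
  by rewrite -!map_comp; apply: eq_map => y; rewrite /= rmorphD.
by rewrite !nth_real_complex lecR (nth_map 0) ?size_eigenvalues.
Qed.

Lemma le_eigenvalues A B k : A \is hermsymmx -> B \is hermsymmx ->
  loewner_le A B -> (eigenvalues A)`_k <= (eigenvalues B)`_k.
Proof.
move=> Ah Bh AB; case: (ltnP k n) => [kn|nk]; last first.
  by rewrite (eigenvalues_default Ah nk) (eigenvalues_default Bh nk).
rewrite -[leRHS]addr0; apply: (le_eigenvaluesD Ah Bh) kn.
by rewrite raddf0 addr0.
Qed.

Lemma sum_eigenvalues A : A \is hermsymmx ->
  (\sum_(k < n) (eigenvalues A)`_k)%:C = \tr A.
Proof.
move=> Ah; have [P AsP] := eigenvalues_frame Ah.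
rewrite (eigenframe_trace AsP) rmorph_sum; apply: eq_bigr => k _.
by rewrite nth_real_complex.
Qed.

Lemma first_eigenvalue_le_qform A x : A \is hermsymmx ->
  ((eigenvalues A)`_0)%:C * dotmx x x <= qform A x.
Proof.
move=> /eigenvalues_frame[P AsP]; rewrite -nth_real_complex.
exact: eigenframe_qform_ge AsP _.
Qed.

Lemma qform_le_last_eigenvalue A x : A \is hermsymmx -> (0 < n)%N ->
  qform A x <= ((eigenvalues A)`_n.-1)%:C * dotmx x x.
Proof.
move=> /eigenvalues_frame[P AsP] n0; rewrite -nth_real_complex.
apply: (eigenframe_qform_le AsP) => [|i]; first by rewrite prednK.
by rewrite -ltnS prednK // ltnNge ltn_ord.
Qed.

Lemma first_eigenvalue_le_diag A i : A \is hermsymmx ->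
  ((eigenvalues A)`_0)%:C <= A i i.
Proof.
move=> Ah; rewrite -[leLHS]mulr1 -(dotmx_delta _ i) -qform_delta.
exact: first_eigenvalue_le_qform.
Qed.

Lemma diag_le_last_eigenvalue A i : A \is hermsymmx ->
  A i i <= ((eigenvalues A)`_n.-1)%:C.
Proof.
move=> Ah; rewrite -[leRHS]mulr1 -(dotmx_delta _ i) -qform_delta.
by apply: qform_le_last_eigenvalue => //; apply: leq_ltn_trans (ltn_ord i).
Qed.

End RealEigenvalues.

Section WeightedAdjacency.
Local Open Scope sesquilinear_scope.
Variables (C : numClosedFieldType) (n : nat) (E : finType).
Variables src tgt : E -> 'I_n.
Implicit Types (w : E -> C) (x : 'rV[C]_n).

Definition adjacency_mx w : 'M[C]_n :=
  \matrix_(v, u) \sum_(e | (src e == v) && (tgt e == u)) w e.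

Definition weighted_degree w : 'rV[C]_n := \row_v \sum_(e | src e == v) w e.

Lemma adjacency_mxB w1 w2 :
  adjacency_mx (fun e => w1 e - w2 e) = adjacency_mx w1 - adjacency_mx w2.
Proof. by apply/matrixP => v u; rewrite !mxE sumrB. Qed.

Lemma adjacency_mxN w : adjacency_mx (fun e => - w e) = - adjacency_mx w.
Proof. by apply/matrixP => v u; rewrite !mxE sumrN. Qed.

Lemma qform_adjacency w x : qform (adjacency_mx w) x =
  \sum_e w e * (x 0 (src e) * (x 0 (tgt e))^*).
Proof.
rewrite qformE (partition_big src predT) //=; apply: eq_bigr => v _.
rewrite (partition_big tgt predT) //=; apply: eq_bigr => u _.
rewrite mxE mulrAC mulr_sumr; apply: eq_bigr => e /andP[/eqP-> /eqP->].
by rewrite mulrC.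
Qed.

Lemma qform_weighted_degree w x : qform (diag_mx (weighted_degree w)) x =
  \sum_e w e * `|x 0 (src e)| ^+ 2.
Proof.
rewrite qform_diag (partition_big src predT) //=; apply: eq_bigr => v _.
by rewrite mxE mulr_suml; apply: eq_bigr => e /eqP->.
Qed.

Variable rev : E -> E.
Hypotheses (revK : involutive rev) (src_rev : forall e, src (rev e) = tgt e).

Lemma adjacency_hermitian w : (forall e, w (rev e) = (w e)^*) ->
  adjacency_mx w \is hermsymmx.
Proof.
move=> w_rev; apply/hermsymmxP/matrixP => v u; rewrite !mxE rmorph_sum.
rewrite [RHS](reindex_inj (can_inj revK)); apply: eq_big => e /=.
  by rewrite -[tgt (rev e)]src_rev revK src_rev andbC.
by rewrite w_rev.
Qed.

(* Orientation reversal makes the two squares in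
   2 |x_u| |x_v| <= |x_u|^2 + |x_v|^2 contribute equally. *)
Lemma adjacency_le_degree w : (forall e, w (rev e) = (w e)^*) ->
  loewner_le (adjacency_mx w) (diag_mx (weighted_degree (fun e => `|w e|))).
Proof.
move=> w_rev x.
have /real_ler_norm/le_trans := qform_real x (adjacency_hermitian w_rev).
apply; rewrite qform_adjacency qform_weighted_degree.
apply: le_trans (ler_norm_sum _ _ _) _.
have tgtE : \sum_e `|w e| * `|x 0 (tgt e)| ^+ 2
    = \sum_e `|w e| * `|x 0 (src e)| ^+ 2.
  rewrite [RHS](reindex_inj (can_inj revK)); apply: eq_bigr => e _.
  by rewrite w_rev norm_conjC src_rev.
apply: (@le_trans _ _ (\sum_e `|w e| *
    ((`|x 0 (src e)| ^+ 2 + `|x 0 (tgt e)| ^+ 2) / 2))).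
  apply: ler_sum => e _; rewrite !normrM norm_conjC ler_wpM2l //.
  by rewrite real_leif_mean_square ?normr_real.
rewrite le_eqVlt; apply/orP; left; apply/eqP.
under eq_bigr do rewrite mulrA mulrDr.
by rewrite -mulr_suml big_split /= tgtE -mulr2n -[X in X / _]mulr_natr mulfK.
Qed.

End WeightedAdjacency.

Lemma sub_floor_period (R : archiRealFieldType) (y T : R) : 0 < T ->
  0 <= y + T *~ - Num.floor (y / T) <= T.
Proof.
move=> T0; have /andP[lo hi] := floor_itv (y / T).
move: lo hi; rewrite ler_pdivlMr // ltr_pdivrMr // intrD mulrDl => lo /ltW hi.
by rewrite mulrNz -mulrzr mulrC; apply/andP; split; lra.
Qed.

Lemma periodicz (U V : zmodType) (f : U -> V) (T : U) : periodic f T ->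
  forall (z : int) a, f (a + T *~ z) = f a.
Proof.
move=> fT [n|n] a; first exact: periodicn.
by rewrite NegzE mulrNz -[LHS](periodicn fT n.+1) -pmulrn subrK.
Qed.

Section Phases.
Local Open Scope complex_scope.
Variables (R : realType) (d : nat).
Implicit Types (s t : R) (m : 'rV[int]_d) (theta : 'rV[R]_d).

Lemma pairingN m theta : pairing (- m) theta = - pairing m theta.
Proof.
by rewrite /pairing -sumrN; apply: eq_bigr => i _; rewrite mxE rmorphN mulNr.
Qed.

Lemma pairing0l theta : pairing (0 : 'rV[int]_d) theta = 0.
Proof. by rewrite /pairing big1 // => i _; rewrite mxE mul0r. Qed.

Lemma pairing0r m : pairing m (0 : 'rV[R]_d) = 0.
Proof. by rewrite /pairing big1 // => i _; rewrite mxE mulr0. Qed.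

Lemma pairing_continuous m : continuous (@pairing d R m).
Proof.
apply: (@continuous_big _ _ _ _ _ add_continuous) => i _ theta.
by apply: continuousM; [exact: cst_continuous|exact: coord_continuous].
Qed.

Lemma expi0 : expi (0 : R) = 1.
Proof. by rewrite /expi cos0 sin0. Qed.

Lemma expiN t : expi (- t) = Num.conj (expi t).
Proof. by rewrite /expi cosN sinN. Qed.

Lemma norm_expi t : `|expi t| = 1.
Proof. by rewrite normc_def /= cos2Dsin2 sqrtr1. Qed.

Lemma expi_periodic t (z : int) : expi (t + (pi *+ 2) *~ z) = expi t.
Proof. by rewrite /expi (periodicz (@cosD2pi R)) (periodicz (@sinD2pi R)). Qed.

Definition expi_dist s t : R := `|cos s - cos t| + `|sin s - sin t|.

Lemma expi_dist_ge0 s t : 0 <= expi_dist s t.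
Proof. by rewrite addr_ge0. Qed.

Lemma expi_distC s t : expi_dist s t = expi_dist t s.
Proof. by rewrite /expi_dist distrC [X in _ + X]distrC. Qed.

Lemma expi_distxx t : expi_dist t t = 0.
Proof. by rewrite /expi_dist !subrr normr0 addr0. Qed.

Lemma expi_dist_continuous s : continuous (expi_dist s).
Proof.
move=> t; have dist_continuous (f : R -> R) : continuous f ->
    {for t, continuous (fun u => `|f s - f u|)}.
  move=> cf; apply: continuous_comp; last exact: norm_continuous.
  by apply: continuousB; [exact: cst_continuous|exact: cf].
exact: continuousD (dist_continuous _ (@continuous_cos R))
  (dist_continuous _ (@continuous_sin R)).
Qed.

Lemma norm_expiB s t : `|expi s - expi t| <= (expi_dist s t)%:C.
Proof.
rewrite normc_def lecR -[leRHS]ger0_norm ?expi_dist_ge0 // -sqrtr_sqr.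
rewrite ler_wsqrtr // [leRHS]sqrrD !real_normK ?num_real // addrAC lerDl.
by rewrite mulrn_wge0 // mulr_ge0.
Qed.

End Phases.

Lemma clos_refl_trans_step (T : Type) (r : relation T) (x y : T) :
  clos_refl_trans T r x y -> x <> y -> exists z, r x z.
Proof.
by move=> xy; case: (clos_rt_rt1n _ _ _ _ xy) => // z t xz _ _; exists z.
Qed.

Section FiberOperators.
Local Open Scope complex_scope.
Local Open Scope sesquilinear_scope.
Variables (R : realType) (d nu : nat) (E : finType) (src tgt : E -> 'I_nu)
  (tau : E -> 'rV[int]_d).
Implicit Types (w : E -> R[i]) (x : 'rV[R[i]]_nu) (Q : 'I_nu -> R)
  (theta : 'rV[R]_d).

Local Notation kap v := ((kappa src v)%:R : R).
Local Notation Hfib := (Hfib src tgt tau).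
Local Notation lam := (lam src tgt tau).

Lemma lamE Q k theta : lam Q k theta = (eigenvalues (Hfib Q theta))`_k.
Proof. by rewrite unlock. Qed.

Definition inv_sqrt_degree : 'M[R[i]]_nu :=
  real_diag (fun v => (Num.sqrt (kap v))^-1).

Definition normalized_adjacency w : 'M[R[i]]_nu :=
  inv_sqrt_degree *m adjacency_mx src tgt w *m inv_sqrt_degree.

Lemma normalized_adjacencyB w1 w2 :
  normalized_adjacency (fun e => w1 e - w2 e)
  = normalized_adjacency w1 - normalized_adjacency w2.
Proof. by rewrite /normalized_adjacency adjacency_mxB mulmxBr mulmxBl. Qed.

Lemma normalized_adjacencyN w :
  normalized_adjacency (fun e => - w e) = - normalized_adjacency w.
Proof. by rewrite /normalized_adjacency adjacency_mxN mulmxN mulNmx. Qed.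

Lemma normalized_adjacencyE w : normalized_adjacency w =
  inv_sqrt_degree *m adjacency_mx src tgt w *m inv_sqrt_degree^t*.
Proof. by rewrite (hermsymmxP _ (real_diag_hermitian _)). Qed.

Definition phase theta e : R[i] := expi (pairing (tau e) theta).

Lemma HfibE Q theta : Hfib Q theta =
  real_diag (fun v => 1 + Q v) - normalized_adjacency (phase theta).
Proof.
apply/matrixP => v u; rewrite /normalized_adjacency /real_diag.
rewrite mul_diag_mx mul_mx_diag !mxE; congr (_ - _).
  by case: eqP => _; rewrite ?addr0 ?mulr1n ?mulr0n.
rewrite mulr_sumr mulr_suml; apply: eq_bigr => e _.
by rewrite sqrtrM // invfM rmorphM /= mulrCA mulrA.
Qed.

Lemma Hfib_periodic Q theta (z : 'rV[int]_d) :
  Hfib Q (theta + \row_i ((pi *+ 2) *~ z 0 i)) = Hfib Q theta.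
Proof.
rewrite !HfibE; congr (_ - normalized_adjacency _); apply/funext => e.
rewrite /phase -[RHS](expi_periodic _ (\sum_i tau e 0 i * z 0 i)); congr expi.
rewrite /pairing -mulrzr rmorph_sum mulr_sumr -big_split /=.
by apply: eq_bigr => i _; rewrite !mxE -mulrzr rmorphM /=; ring.
Qed.

Definition phase_dist theta theta' : R :=
  \sum_e expi_dist (pairing (tau e) theta) (pairing (tau e) theta').

Lemma phase_distC theta theta' :
  phase_dist theta theta' = phase_dist theta' theta.
Proof. by apply: eq_bigr => e _; exact: expi_distC. Qed.

Lemma phase_distxx theta : phase_dist theta theta = 0.
Proof. by rewrite /phase_dist big1 // => e _; exact: expi_distxx. Qed.

Lemma phase_dist_continuous theta : continuous (phase_dist theta).
Proof.
apply: (@continuous_big _ _ _ _ _ add_continuous) => e _ theta'.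
apply: continuous_comp; first exact: pairing_continuous.
exact: expi_dist_continuous.
Qed.

Variable rev : E -> E.
Hypothesis orient : orientation_ok src tgt rev tau.

Let revK : involutive rev. Proof. by case: orient. Qed.
Let src_rev e : src (rev e) = tgt e. Proof. by case: orient => _ [_ []]. Qed.
Let tau_rev e : tau (rev e) = - tau e.
Proof. by case: orient => _ [_ [_ []]]. Qed.

Lemma normalized_adjacency_hermitian w :
  (forall e, w (rev e) = Num.conj (w e)) ->
  normalized_adjacency w \is hermsymmx.
Proof.
move=> w_rev; apply/hermsymmxP; rewrite normalized_adjacencyE.
rewrite !trmx_mul !map_mxM trmxCK mulmxA.
by rewrite (hermsymmxP _ (adjacency_hermitian revK src_rev w_rev)).
Qed.

Lemma normalized_adjacency_le w (c : E -> R) :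
    (forall e, w (rev e) = Num.conj (w e)) -> (forall e, `|w e| <= (c e)%:C) ->
  loewner_le (normalized_adjacency w)
    (real_diag (fun v => (\sum_(e | src e == v) c e) / kap v)).
Proof.
move=> w_rev wc; rewrite normalized_adjacencyE.
have adj_le := adjacency_le_degree revK src_rev w_rev.
apply: loewner_le_trans (loewner_le_conj _ adj_le) _.
rewrite (hermsymmxP _ (real_diag_hermitian _)) /inv_sqrt_degree /real_diag.
rewrite !mulmx_diag; apply: loewner_le_diag => v.
rewrite !mxE mulrAC -rmorphM /= -invfM.
rewrite -expr2 sqr_sqrtr // [X in _ <= X%:C]mulrC rmorphM ler_wpM2l //.
  by rewrite ler0c invr_ge0.
by rewrite rmorph_sum; apply: ler_sum.
Qed.

Lemma normalized_adjacency_ge w (c : E -> R) :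
    (forall e, w (rev e) = Num.conj (w e)) -> (forall e, `|w e| <= (c e)%:C) ->
  loewner_le (- real_diag (fun v => (\sum_(e | src e == v) c e) / kap v))
    (normalized_adjacency w).
Proof.
move=> w_rev wc; rewrite -[X in loewner_le _ X]opprK -normalized_adjacencyN.
apply/loewner_leN2/normalized_adjacency_le => e; last by rewrite normrN.
by rewrite w_rev rmorphN.
Qed.

Lemma phase_rev theta e : phase theta (rev e) = Num.conj (phase theta e).
Proof. by rewrite /phase tau_rev pairingN expiN. Qed.

Lemma Hfib_hermitian Q theta : Hfib Q theta \is hermsymmx.
Proof.
rewrite HfibE hermsymmxD ?real_diag_hermitian // hermsymmxN //.
exact/normalized_adjacency_hermitian/phase_rev.
Qed.

Definition bridge_phase theta e : R[i] :=
  if tau e == 0 then 0 else phase theta e.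

Definition bridgeless Q : 'M[R[i]]_nu :=
  real_diag (fun v => 1 + Q v)
  - normalized_adjacency (fun e => (tau e == 0)%:R).

Definition bridge_degree : 'M[R[i]]_nu :=
  real_diag (fun v => (beta_v src tau v)%:R / kap v).

Lemma Hfib_bridges Q theta :
  Hfib Q theta = bridgeless Q - normalized_adjacency (bridge_phase theta).
Proof.
have index0E : (fun e => (tau e == 0)%:R)
    = (fun e => phase theta e - bridge_phase theta e).
  apply/funext => e; rewrite /bridge_phase /phase.
  by case: eqP => [->|_]; rewrite ?pairing0l ?expi0 ?subr0 ?subrr.
rewrite /bridgeless index0E normalized_adjacencyB opprB addrA addrAC addrK.
exact: HfibE.
Qed.

Lemma bridgeless_hermitian Q : bridgeless Q \is hermsymmx.
Proof.
rewrite hermsymmxD ?real_diag_hermitian // hermsymmxN //.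
apply: normalized_adjacency_hermitian => e.
by rewrite tau_rev oppr_eq0 rmorph_nat.
Qed.

Lemma bridge_phase_rev theta e :
  bridge_phase theta (rev e) = Num.conj (bridge_phase theta e).
Proof.
rewrite /bridge_phase tau_rev oppr_eq0.
by case: eqP; rewrite ?rmorph0 ?phase_rev.
Qed.

Lemma norm_bridge_phase theta e :
  `|bridge_phase theta e| <= ((tau e != 0)%:R)%:C.
Proof.
by rewrite /bridge_phase; case: eqP => _; rewrite ?normr0 // norm_expi.
Qed.

Lemma bridge_degreeE : bridge_degree =
  real_diag (fun v => (\sum_(e | src e == v) (tau e != 0)%:R) / kap v).
Proof.
congr diag_mx; apply/rowP => v; rewrite !mxE; congr (_ / _)%:C.
rewrite /beta_v -sum1_card natr_sum big_mkcond [RHS]big_mkcond.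
by apply: eq_bigr => e _; rewrite inE; case: (src e == v) => //=; case: eqP.
Qed.

Lemma Hfib_le_bridgeless Q theta :
  loewner_le (Hfib Q theta) (bridgeless Q + bridge_degree).
Proof.
rewrite Hfib_bridges bridge_degreeE -[X in loewner_le _ (_ + X)]opprK.
apply/loewner_leD2l/loewner_leN2/normalized_adjacency_ge.
  exact: bridge_phase_rev.
exact: norm_bridge_phase.
Qed.

Lemma Hfib_ge_bridgeless Q theta :
  loewner_le (bridgeless Q - bridge_degree) (Hfib Q theta).
Proof.
rewrite Hfib_bridges bridge_degreeE.
apply/loewner_leD2l/loewner_leN2/normalized_adjacency_le.
  exact: bridge_phase_rev.
exact: norm_bridge_phase.
Qed.

Lemma bridgelessB_hermitian Q : bridgeless Q - bridge_degree \is hermsymmx.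
Proof.
exact: hermsymmxD (bridgeless_hermitian Q) (hermsymmxN (real_diag_hermitian _)).
Qed.

Lemma bridgelessD_hermitian Q : bridgeless Q + bridge_degree \is hermsymmx.
Proof. exact: hermsymmxD (bridgeless_hermitian Q) (real_diag_hermitian _). Qed.

Lemma trace_bridge_degree : \tr bridge_degree = (beta src tau R)%:C.
Proof.
by rewrite mxtrace_diag rmorph_sum; apply: eq_bigr => v _; rewrite mxE.
Qed.

Lemma lam_bounds Q : exists lo hi : nat -> R,
  (forall k theta, lo k <= lam Q k theta <= hi k) /\
  \sum_(k < nu) (hi k - lo k) = 2 * beta src tau R.
Proof.
have lower_herm := bridgelessB_hermitian Q.
have upper_herm := bridgelessD_hermitian Q.
exists (nth 0 (eigenvalues (bridgeless Q - bridge_degree))),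
  (nth 0 (eigenvalues (bridgeless Q + bridge_degree))).
split=> [k theta|].
  rewrite lamE; have Hh := Hfib_hermitian Q theta; apply/andP; split.
    exact: le_eigenvalues lower_herm Hh (Hfib_ge_bridgeless Q theta).
  exact: le_eigenvalues Hh upper_herm (Hfib_le_bridgeless Q theta).
apply: (@complexI R); rewrite sumrB rmorphB /=.
rewrite (sum_eigenvalues upper_herm) (sum_eigenvalues lower_herm) -raddfB /=.
rewrite opprB addrC addrA subrK mxtraceD trace_bridge_degree -mulr2n.
by rewrite rmorphM /= rmorph_nat mulr_natl.
Qed.

Lemma lam_default Q k theta : (nu <= k)%N -> lam Q k theta = 0.
Proof.
by move=> nuk; rewrite lamE (eigenvalues_default (Hfib_hermitian _ _)).
Qed.

Lemma Hfib_le_phase_dist Q theta theta' :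
  loewner_le (Hfib Q theta) (Hfib Q theta' + (phase_dist theta theta')%:C%:M).
Proof.
have -> : Hfib Q theta = Hfib Q theta'
    + normalized_adjacency (fun e => phase theta' e - phase theta e).
  by rewrite normalized_adjacencyB !HfibE addrA subrK.
apply: loewner_leD2l.
apply: loewner_le_trans (normalized_adjacency_le _ _) _ => [e|e|].
- by rewrite !phase_rev rmorphB.
- exact: norm_expiB.
rewrite -real_diag_const; apply: real_diag_le => v; rewrite phase_distC.
have dist_ge0 e :=
  expi_dist_ge0 (pairing (tau e) theta') (pairing (tau e) theta).
rewrite [leRHS](bigID (fun e => src e == v)) /=.
apply: ler_wpDr; first exact: sumr_ge0.
rewrite ler_piMr //; first exact: sumr_ge0.
by case: (kappa _ _) => [|m]; rewrite ?invr0 // invf_le1 ?ltr0n // ler1n.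
Qed.

Lemma lam_le_phase_dist Q k theta theta' :
  lam Q k theta <= lam Q k theta' + phase_dist theta theta'.
Proof.
case: (ltnP k nu) => [knu|nuk]; last first.
  by rewrite !lam_default // add0r sumr_ge0 // => e _; exact: expi_dist_ge0.
rewrite !lamE; exact: le_eigenvaluesD (Hfib_hermitian _ _) (Hfib_hermitian _ _)
  (Hfib_le_phase_dist _ _ _) knu.
Qed.

Lemma Hfib_potential Q theta :
  Hfib Q theta = Hfib (fun=> 0) theta + real_diag Q.
Proof.
rewrite !HfibE !real_diagD (@real_diag_const R nu 0) !raddf0 addr0.
exact: addrAC.
Qed.

Lemma Hfib_diag Q theta v :
  Hfib Q theta v v = Hfib (fun=> 0) theta v v + (Q v)%:C.
Proof.
by rewrite Hfib_potential [LHS]mxE; congr (_ + _); rewrite !mxE eqxx mulr1n.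
Qed.

Lemma lam_le_potential Q Q' (a : R) k theta : (k < nu)%N ->
  (forall v, Q v <= Q' v + a) -> lam Q k theta <= lam Q' k theta + a.
Proof.
move=> knu QQ'; rewrite !lamE.
apply: (le_eigenvaluesD (Hfib_hermitian Q theta) (Hfib_hermitian Q' theta)) knu.
rewrite (Hfib_potential Q) (Hfib_potential Q') -addrA.
apply: loewner_leD2l; rewrite -real_diag_const -real_diagD.
exact: real_diag_le.
Qed.

Lemma sum_out_edges v : \sum_(e | src e == v) 1 = kap v.
Proof.
by rewrite /kappa -sum1_card natr_sum; apply: eq_bigl => e; rewrite inE.
Qed.

Lemma Laplacian_ge0 theta x : 0 <= qform (Hfib (fun=> 0) theta) x.
Proof.
rewrite HfibE qformD qformN subr_ge0.
have phase1 e : `|phase theta e| <= 1%:C by rewrite norm_expi.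
apply: le_trans (normalized_adjacency_le (phase_rev theta) phase1 x) _.
apply: real_diag_le => v; rewrite addr0 sum_out_edges.
by case: (kappa _ _) => [|m]; rewrite ?mul0r // divff // pnatr_eq0.
Qed.

Lemma potential_le_last_lam Q v theta : Q v <= lam Q nu.-1 theta.
Proof.
have Hh := Hfib_hermitian Q theta.
rewrite lamE -lecR; apply: le_trans (diag_le_last_eigenvalue v Hh).
by rewrite Hfib_diag lerDr -qform_delta Laplacian_ge0.
Qed.

Lemma first_lam_le_potential Q v theta :
  lam Q 0 theta <= lam (fun=> 0) nu.-1 theta + Q v.
Proof.
have Hh := Hfib_hermitian Q theta.
rewrite !lamE -lecR; apply: le_trans (first_eigenvalue_le_diag v Hh) _.
rewrite Hfib_diag rmorphD lerD2r.
exact/diag_le_last_eigenvalue/Hfib_hermitian.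
Qed.

Definition sqrt_degree : 'rV[R[i]]_nu := \row_v (Num.sqrt (kap v))%:C.

Lemma Laplacian_sqrt_degree :
  (forall v, (0 < kappa src v)%N) -> qform (Hfib (fun=> 0) 0) sqrt_degree = 0.
Proof.
move=> kappa_gt0; rewrite HfibE qformD qformN normalized_adjacencyE qform_conj.
have -> : sqrt_degree *m inv_sqrt_degree = const_mx 1.
  apply/rowP => v; rewrite mul_mx_diag !mxE -rmorphM divff //.
  by rewrite sqrtr_eq0 -ltNge ltr0n.
apply/eqP; rewrite subr_eq0 qform_diag qform_adjacency; apply/eqP.
rewrite [RHS](partition_big src predT) //=; apply: eq_bigr => v _.
transitivity ((kap v)%:C).
  rewrite !mxE addr0 mul1r ger0_norm ?ler0c ?sqrtr_ge0 // -rmorphXn /=.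
  by rewrite sqr_sqrtr.
rewrite -sum_out_edges rmorph_sum; apply: eq_bigr => e _.
by rewrite /phase pairing0r expi0 !mxE conjC1 !mulr1.
Qed.

Lemma first_Laplacian_lam_le0 : (0 < nu)%N ->
  (forall v, (0 < kappa src v)%N) -> lam (fun=> 0) 0 (0 : 'rV[R]_d) <= 0.
Proof.
move=> nu0 kappa_gt0.
rewrite lamE -lecR -(@pmulr_lle0 _ (dotmx sqrt_degree sqrt_degree)).
  rewrite -(Laplacian_sqrt_degree kappa_gt0).
  exact/first_eigenvalue_le_qform/Hfib_hermitian.
rewrite dnorm_gt0; apply/eqP => /rowP/(_ (Ordinal nu0)); rewrite !mxE.
move=> /complexI/eqP; rewrite sqrtr_eq0 leNgt ltr0n.
by rewrite kappa_gt0.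
Qed.

Lemma kappa_gt0 (v : 'I_nu) : (0 < d)%N -> Gamma_connected src tgt tau ->
  (0 < kappa src v)%N.
Proof.
move=> d_gt0 conn.
have [|_ [e [src_e _]]] := clos_refl_trans_step (conn (v, 0) (v, const_mx 1)).
  by case=> /rowP/(_ (Ordinal d_gt0))/eqP; rewrite !mxE.
by apply/card_gt0P; exists e; rewrite inE src_e.
Qed.

End FiberOperators.

Lemma content_bigsetU_le (d : measure_display) (R : realFieldType)
    (T : ringOfSetsType d) (mu : {content set T -> \bar R})
    (I : Type) (s : seq I) (F : I -> set T) :
  (forall i, measurable (F i)) ->
  (mu (\big[setU/set0]_(i <- s) F i)%classic <= \sum_(i <- s) mu (F i))%E.
Proof.
move=> Fm; elim: s => [|i s IHs]; first by rewrite !big_nil measure0.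
rewrite !big_cons; apply: le_trans (measureU2 _ _ _) (leeD2l _ IHs) => //.
by apply: bigsetU_measurable => j _; exact: Fm.
Qed.

Section RealSets.
Variable R : realType.
Local Open Scope classical_set_scope.
Implicit Types (S : set R) (gs : seq (R * R)).

Lemma closed_sup_mem S : closed S -> S !=set0 -> has_ubound S -> S (sup S).
Proof.
move=> cS S0 Sub; apply: (itv_closed_supremums S0 cS).
by split; [exact: ub_le_sup|move=> m; exact: ge_sup].
Qed.

Lemma closed_inf_mem S : closed S -> S !=set0 -> has_lbound S -> S (inf S).
Proof.
move=> cS S0 Slb; apply: (itv_closed_infimums S0 cS).
by split; [exact: ge_inf|move=> m; exact: lb_le_inf].
Qed.

Lemma sup_range_fin (T : finType) (f : T -> R) (t : T) :
  (forall u, f u <= f t) -> sup (range f) = f t.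
Proof.
move=> f_max; apply/le_anti/andP; split.
  by apply: ge_sup => [|_ [u _ <-]]; first by exists (f t), t.
by apply: ub_le_sup; [exists (f t) => _ [u _ <-]|exists t].
Qed.

Lemma inf_range_fin (T : finType) (f : T -> R) (t : T) :
  (forall u, f t <= f u) -> inf (range f) = f t.
Proof.
move=> f_min; rewrite /inf image_comp (@sup_range_fin _ _ t) ?opprK // => u.
by rewrite lerN2.
Qed.

Definition gap_of S (g : R * R) : Prop :=
  g.1 < g.2 /\ S g.1 /\ S g.2 /\ `]g.1, g.2[ `&` S = set0.

Lemma gap_around S (a b y : R) : closed S -> S a -> S b -> a <= y <= b ->
  ~ S y -> exists2 g, gap_of S g & g.1 < y < g.2.
Proof.
move=> cS Sa Sb /andP[ay yb] Sy.
pose A := S `&` [set z | z <= y]; pose B := S `&` [set z | y <= z].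
have ubA : has_ubound A by exists y => z [].
have lbB : has_lbound B by exists y => z [].
have [Ss sy] : A (sup A).
  by apply: closed_sup_mem ubA; [exact: closedI (@closed_le _ y)|exists a].
have [Si yi] : B (inf B).
  by apply: closed_inf_mem lbB; [exact: closedI (@closed_ge _ y)|exists b].
have {}sy : sup A < y.
  by rewrite lt_neqAle sy andbT; apply: contra_notN Sy => /eqP<-.
have {}yi : y < inf B.
  by rewrite lt_neqAle yi andbT; apply: contra_notN Sy => /eqP->.
exists (sup A, inf B); last by rewrite /= sy.
do !split => //; first exact: lt_trans yi.
apply/seteqP; split => // z [] /=; rewrite in_itv /= => /andP[sz zi] Sz.
case: (leP z y) => zy.
  by have := ub_le_sup ubA (conj Sz zy); rewrite leNgt sz.
by have := ge_inf lbB (conj Sz (ltW zy)); rewrite leNgt zi.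
Qed.

Local Notation mu := (@lebesgue_measure R).

Lemma lebesgue_measure_segment (a b : R) : a <= b -> mu `[a, b] = (b - a)%:E.
Proof.
move=> ab; rewrite lebesgue_measure_itv /= lte_fin.
by case: ltgtP ab => // -> _; rewrite subrr.
Qed.

Lemma segment_length_le_gaps S (a b : R) gs : closed S -> S a -> S b ->
    (forall g, gap_of S g <-> g \in gs) ->
  ((b - a)%:E <= mu S + (\sum_(g <- gs) (g.2 - g.1))%:E)%E.
Proof.
move=> cS Sa Sb gsP; have gs_lt g : g \in gs -> g.1 < g.2 by move/gsP => [].
have gapsE : \sum_(g <- gs) mu `]g.1, g.2[ = (\sum_(g <- gs) (g.2 - g.1))%:E.
  rewrite -sumEFin big_seq [RHS]big_seq; apply: eq_bigr => g /gs_lt g12.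
  by rewrite lebesgue_measure_itv /= lte_fin g12.
rewrite -gapsE; case: (leP a b) => [ab|ba]; last first.
  apply: (@le_trans _ _ 0%E); first by rewrite lee_fin subr_le0 ltW.
  by rewrite adde_ge0 // sume_ge0.
have Sm : measurable S by exact: closed_measurable.
pose U := \big[setU/set0]_(g <- gs) (`]g.1, g.2[ : set R).
have Um : measurable U.
  by apply: bigsetU_measurable => g _; exact: measurable_itv.
have cover : `[a, b] `<=` S `|` U.
  move=> y /=; rewrite in_itv /= => yab.
  have [Sy|Sy] := pselect (S y); [by left|right].
  have [g /gsP g_in yg] := gap_around cS Sa Sb yab Sy.
  by rewrite /U -bigcup_seq; exists g => //=; rewrite in_itv.
rewrite -lebesgue_measure_segment //.
apply: le_trans (le_measure mu _ _ cover) _; rewrite ?inE //.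
  exact: measurableU.
apply: le_trans (measureU2 mu Sm Um) (leeD2l _ _).
by apply: content_bigsetU_le => g; exact: measurable_itv.
Qed.

End RealSets.

Section Bands.
Local Open Scope classical_set_scope.
Variables (R : realType) (d nu : nat) (E : finType) (src tgt : E -> 'I_nu)
  (rev : E -> E) (tau : E -> 'rV[int]_d).
Implicit Types (Q : 'I_nu -> R) (theta : 'rV[R]_d) (gs : seq (R * R)).

Local Notation Hfib := (Hfib src tgt tau).
Local Notation lam := (lam src tgt tau).
Local Notation band := (band src tgt tau).
Local Notation band_lo := (band_lo src tgt tau).
Local Notation band_hi := (band_hi src tgt tau).
Local Notation spectrum := (spectrum src tgt tau).
Local Notation mu := (@lebesgue_measure R).
Local Notation beta := (beta src tau R).

Lemma band_fundamental_box Q k : band Q k =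
  lam Q k @` [set theta : 'rV[R]_d | forall i, `[0, pi *+ 2] (theta ord0 i)].
Proof.
apply/seteqP; split=> [_ [theta _ <-]|_ [theta _ <-]]; last by exists theta.
pose z : 'rV[int]_d := \row_i - Num.floor (theta 0 i / (pi *+ 2)).
exists (theta + \row_i ((pi *+ 2) *~ z 0 i)).
  move=> i; rewrite !mxE /= in_itv /=.
  by apply: sub_floor_period; rewrite mulrn_wgt0 // pi_gt0.
by rewrite /Defs.lam /eigs Hfib_periodic.
Qed.

Hypothesis orient : orientation_ok src tgt rev tau.

Lemma lam_continuous Q k : continuous (lam Q k).
Proof.
move=> theta.
have dist_cvg0 : phase_dist tau theta t @[t --> theta] --> (0 : R).
  by rewrite -(phase_distxx tau theta); exact: phase_dist_continuous.
have upper t : lam Q k t <= lam Q k theta + phase_dist tau theta t.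
  by rewrite phase_distC; exact: lam_le_phase_dist orient _ _ _ _.
have lower t : lam Q k theta - phase_dist tau theta t <= lam Q k t.
  by rewrite lerBlDr; exact: lam_le_phase_dist orient _ _ _ _.
apply: (@squeeze_cvgr _ (nbhs theta) _ _
  (fun t => lam Q k theta - phase_dist tau theta t)
  (fun t => lam Q k theta + phase_dist tau theta t)).
- by apply: nearW => t; rewrite lower upper.
- by rewrite -[X in _ --> X]subr0; apply: cvgB dist_cvg0; exact: cvg_cst.
- by rewrite -[X in _ --> X]addr0; apply: cvgD dist_cvg0; exact: cvg_cst.
Qed.

Lemma band_compact Q k : compact (band Q k).
Proof.
rewrite band_fundamental_box; apply: continuous_compact.
  exact/continuous_subspaceT/lam_continuous.
by apply: (@rV_compact _ _ (fun=> `[0, pi *+ 2])) => _; exact: segment_compact.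
Qed.

Lemma band_closed Q k : closed (band Q k).
Proof. by apply: compact_closed (@Rhausdorff R) _; exact: band_compact. Qed.

Lemma band_measurable Q k : measurable (band Q k).
Proof. exact: closed_measurable (@band_closed Q k). Qed.

Lemma band_neq0 Q k : band Q k !=set0.
Proof. by exists (lam Q k 0), 0. Qed.

Lemma band_has_ubound Q k : has_ubound (band Q k).
Proof. by have [] := compact_has_sup (band_neq0 Q k) (@band_compact Q k). Qed.

Lemma band_has_lbound Q k : has_lbound (band Q k).
Proof.
have [lo [hi [lam_itv _]]] := lam_bounds orient Q.
by exists (lo k) => _ [theta _ <-]; have /andP[] := lam_itv k theta.
Qed.

Lemma band_hi_mem Q k : band Q k (band_hi Q k).
Proof.
exact: closed_sup_mem (@band_closed Q k) (band_neq0 Q k) (band_has_ubound Q k).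
Qed.

Lemma band_lo_mem Q k : band Q k (band_lo Q k).
Proof.
exact: closed_inf_mem (@band_closed Q k) (band_neq0 Q k) (band_has_lbound Q k).
Qed.

Lemma lam_le_band_hi Q k theta : lam Q k theta <= band_hi Q k.
Proof. by apply: ub_le_sup (band_has_ubound Q k) _ _; exists theta. Qed.

Lemma band_lo_le_lam Q k theta : band_lo Q k <= lam Q k theta.
Proof. by apply: ge_inf (band_has_lbound Q k) _ _; exists theta. Qed.

Lemma band_default Q k : (nu <= k)%N -> band Q k = [set 0].
Proof.
move=> nuk; apply/seteqP; split=> [_ [theta _ <-]|_ ->].
  by rewrite (lam_default orient).
by exists 0 => //; rewrite (lam_default orient).
Qed.

Lemma spectrum_closed Q : closed (spectrum Q).
Proof. by apply: closed_bigcup => // k _; exact: band_closed. Qed.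

Lemma measure_spectrum_le Q :
  (mu (spectrum Q) <= \sum_(n < nu) mu (band Q n))%E.
Proof.
rewrite /Defs.spectrum bigcup_mkord; apply: content_bigsetU_le => k.
exact: band_measurable.
Qed.

Lemma measure_bands_le Q : (\sum_(n < nu) mu (band Q n) <= (2 * beta)%:E)%E.
Proof.
have [lo [hi [lam_itv <-]]] := lam_bounds orient Q.
rewrite -sumEFin; apply: lee_sum => n _.
have /andP[lo_le le_hi] := lam_itv n 0.
rewrite -lebesgue_measure_segment; last exact: le_trans lo_le le_hi.
apply: le_measure; rewrite ?inE //; first exact: band_measurable.
by move=> _ [theta _ <-] /=; rewrite in_itv /=.
Qed.

Lemma beta_ge0 : 0 <= beta.
Proof. by apply: sumr_ge0 => v _; rewrite divr_ge0. Qed.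

Lemma total_gap_length_ge Q gs :
    (forall g, is_gap src tgt tau Q g <-> g \in gs) ->
  band_hi Q nu.-1 - band_lo Q 0 - 2 * beta <= \sum_(g <- gs) (g.2 - g.1).
Proof.
move=> gsP; have [nu0|nu_gt0] := posnP nu.
  rewrite /Defs.band_hi /Defs.band_lo !band_default ?nu0 // sup1 inf1 subrr.
  apply: (@le_trans _ _ 0); first by rewrite subr_le0 mulr_ge0 ?beta_ge0.
  rewrite big_seq; apply: sumr_ge0 => g /gsP[g12 _].
  by rewrite subr_ge0 ltW.
have Slo : spectrum Q (band_lo Q 0) by exists 0%N => //; exact: band_lo_mem.
have Shi : spectrum Q (band_hi Q nu.-1).
  by exists nu.-1; [rewrite /= prednK|exact: band_hi_mem].
rewrite lerBlDl -lee_fin [leRHS]EFinD.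
apply: le_trans (segment_length_le_gaps (@spectrum_closed Q) Slo Shi gsP) _.
by rewrite leeD2r // (le_trans (measure_spectrum_le Q)) ?measure_bands_le.
Qed.

Lemma qbullet_attained Q : (0 < nu)%N -> exists vmin vmax : 'I_nu,
  (forall v, Q vmin <= Q v <= Q vmax) /\ qbullet Q = Q vmax - Q vmin.
Proof.
move=> nu_gt0; pose v0 := Ordinal nu_gt0.
case: (@arg_maxP _ _ _ v0 predT Q isT) => vmax _ Qmax.
case: (@arg_minP _ _ _ v0 predT Q isT) => vmin _ Qmin.
exists vmin, vmax; split=> [v|].
  by apply/andP; split; [exact: Qmin|exact: Qmax].
by congr (_ - _); [apply: sup_range_fin => v; exact: Qmax
                  |apply: inf_range_fin => v; exact: Qmin].
Qed.

Lemma band_hi_le_potential Q Q' (a : R) k : (k < nu)%N ->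
  (forall v, Q v <= Q' v + a) -> band_hi Q k <= band_hi Q' k + a.
Proof.
move=> knu QQ'; apply: ge_sup => [|_ [theta _ <-]]; first exact: band_neq0.
apply: le_trans (lam_le_potential orient theta knu QQ') _.
by rewrite lerD2r; exact: lam_le_band_hi.
Qed.

Lemma potential_le_last_band_hi Q v : Q v <= band_hi Q nu.-1.
Proof.
exact: le_trans (potential_le_last_lam orient Q v 0) (lam_le_band_hi _ _ _).
Qed.

Lemma first_band_lo_le_potential Q v :
  band_lo Q 0 <= band_hi (fun=> 0) nu.-1 + Q v.
Proof.
apply: le_trans (band_lo_le_lam Q 0 0) _.
apply: le_trans (first_lam_le_potential orient Q v 0) _.
by rewrite lerD2r; exact: lam_le_band_hi.
Qed.

Lemma first_band_lo_le Q (a : R) : (0 < nu)%N ->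
  (forall v, (0 < kappa src v)%N) -> (forall v, Q v <= a) -> band_lo Q 0 <= a.
Proof.
move=> nu_gt0 kappa_gt0 Qa; apply: le_trans (band_lo_le_lam Q 0 0) _.
apply: (@le_trans _ _ (lam (fun=> 0) 0 0 + a)).
  by apply: (lam_le_potential orient) => // v; rewrite add0r.
by rewrite gerDr; exact: first_Laplacian_lam_le0 orient nu_gt0 kappa_gt0.
Qed.

Lemma spectrum_width_ge Q : (0 < d)%N -> Gamma_connected src tgt tau ->
  `|band_hi (fun=> 0) nu.-1 - qbullet Q| <= band_hi Q nu.-1 - band_lo Q 0.
Proof.
move=> d_gt0 conn; have [nu0|nu_gt0] := posnP nu.
  have rangeQ : range Q = set0.
    by apply/seteqP; split=> // y [[v v_lt] _ _]; exfalso; rewrite nu0 in v_lt.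
  rewrite /qbullet rangeQ sup0 inf0 /Defs.band_hi /Defs.band_lo.
  by rewrite !band_default ?nu0 // sup1 inf1 !subrr normr0.
have [vmin [vmax [Q_bounds ->]]] := qbullet_attained Q nu_gt0.
have kappa_gt0 v := kappa_gt0 v d_gt0 conn.
have lo_le_max : band_lo Q 0 <= Q vmax.
  by apply: first_band_lo_le => // v; have /andP[] := Q_bounds v.
have hi0_le : band_hi (fun=> 0) nu.-1 <= band_hi Q nu.-1 - Q vmin.
  apply: band_hi_le_potential => [|v]; first by rewrite prednK.
  by rewrite subr_ge0; have /andP[] := Q_bounds v.
move: lo_le_max hi0_le (potential_le_last_band_hi Q vmax).
move: (first_band_lo_le_potential Q vmin).
move: (band_hi Q _) (band_hi _ _) (band_lo Q _) => hi hi0 lo *.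
by rewrite ler_norml; apply/andP; split; lra.
Qed.

End Bands.

Theorem theorem2p2 (R : realType) (d nu : nat) (E : finType)
  (src tgt : E -> 'I_nu) (rev : E -> E) (tau : E -> 'rV[int]_d)
  (Q : 'I_nu -> R) :
  (2 <= d)%N ->
  orientation_ok src tgt rev tau ->
  Gamma_connected src tgt tau ->
  indices_from_tree src tgt tau ->
  let mu := @lebesgue_measure R in
  let b := beta src tau R in
  let lam1m := band_lo src tgt tau Q 0 in
  let lamnup := band_hi src tgt tau Q nu.-1 in
  let lam0nup := band_hi src tgt tau (fun _ => 0) nu.-1 in
  let C0 := `|lam0nup - qbullet Q| in
  ((mu (spectrum src tgt tau Q)
      <= \sum_(n < nu) mu (band src tgt tau Q n))%E /\
   (\sum_(n < nu) mu (band src tgt tau Q n) <= (2 * b)%:E)%E) /\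
  (forall gs : seq (R * R), uniq gs ->
     (forall g, is_gap src tgt tau Q g <-> g \in gs) ->
     lamnup - lam1m - 2 * b <= \sum_(g <- gs) (g.2 - g.1) /\
     C0 - 2 * b <= lamnup - lam1m - 2 * b).
Proof.
move=> d_ge2 orient conn _ mu b lam1m lamnup lam0nup C0; split.
  split; first exact: measure_spectrum_le orient Q.
  exact: measure_bands_le orient Q.
move=> gs _ gsP; split; first exact: (total_gap_length_ge orient gsP).
by rewrite lerD2r; exact: (spectrum_width_ge orient Q (ltnW d_ge2) conn).
Qed.
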